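(* Let $\mathbb{C}$ be a finite disjoint union of cycles and let $\mathbb{B}$ be a finite structure with finite relational signature. Then $\mathbb{B}\leq\mathbb{C}$ if and only if for all prime cyclic loop conditions $\Sigma$: $\operatorname{Pol}(\mathbb{B})\models\Sigma$ implies $\operatorname{Pol}(\mathbb{C})\models\Sigma$.
   Context: All structures are nonempty. Pp-constructability. For a relational structure $\mathbb{A}$ with domain $A$, a pp-power of $\mathbb{A}$ is a structure isomorphic to one with domain $A^n$, $n\in\mathbb{N}^+$, all of whose relations are definable in $\mathbb{A}$ by primitive positive formulas (existentially quantified conjunctions of atomic formulas, equality allowed), where a $k$-ary relation on $A^n$ is regarded as a $kn$-ary relation on $A$. Two structures are homomorphically equivalent if there are homomorphisms between them in both directions. $\mathbb{A}\leq\mathbb{B}$ (''$\mathbb{A}$ pp-constructs $\mathbb{B}$'') means that $\mathbb{B}$ is homomorphically equivalent to a pp-power of $\mathbb{A}$. A finite disjoint union of cycles is a finite digraph all of whose connected components are directed cycles (a loop is a cycle of length 1). $\operatorname{Pol}(\mathbb{A})$ is the set of all homomorphisms $\mathbb{A}^n\to\mathbb{A}$, $n\geq1$. The prime cyclic loop conditions are the conditions $\Sigma_P$, $P$ a finite nonempty set of primes, where, with $V_P=\{(p,k)\mid p\in P,k\in\mathbb{Z}_p\}$ and $\sigma_P\colon V_P\to V_P$, $(p,k)\mapsto(p,k+1)$, $\operatorname{Pol}(\mathbb{A})\models\Sigma_P$ means that there is a homomorphism $f\colon\mathbb{A}^{V_P}\to\mathbb{A}$ with $f(t)=f(t\circ\sigma_P)$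 for all $t\in A^{V_P}$. *)

(* Defs.v *)
From mathcomp Require Import all_boot all_algebra.
From mathcomp Require Import finmap.

Set Implicit Arguments.
Unset Strict Implicit.
Unset Printing Implicit Defensive.

Record signature := Signature {
  symbol :> finType;
  arity : symbol -> nat
}.

(* Nonempty finite structures only: this is closed under every construction
   used below (finite powers, pp-powers). *)
Record relstruct (S : signature) := RelStruct {
  dom :> finType;
  interp : forall R : S, pred ((arity R).-tuple dom);
  dom_gt0 : 0 < #|dom|
}.
Arguments interp {S} A R t : rename.

Section Homomorphisms.
Variable S : signature.

Definition is_hom (A B : relstruct S) (f : A -> B) : Prop :=
  forall (R : S) (t : (arity R).-tuple A),
    interp A R t -> interp B R (map_tuple f t).

Definition hom_equiv (A B : relstruct S) : Prop :=
  (exists f : A -> B, is_hom f) /\ (exists g : B -> A, is_hom g).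

Definition isomorphic (A B : relstruct S) : Prop :=
  exists2 f : A -> B, bijective f &
    forall (R : S) (t : (arity R).-tuple A),
      interp B R (map_tuple f t) = interp A R t.

End Homomorphisms.

Section PPFormulas.
Variable S : signature.

Inductive atom (X : Type) :=
  | RelAtom (R : S) (args : (arity R).-tuple X)
  | EqAtom (x y : X).

(* Free variables are indexed by [X]; the existentially quantified ones by
   ['I_(pp_nbound phi)]. *)
Record pp_formula (X : Type) := PPFormula {
  pp_nbound : nat;
  pp_atoms : seq (atom (X + 'I_pp_nbound))
}.

Variable A : relstruct S.

Definition sat_atom (X : Type) (v : X -> A) (a : atom X) : bool :=
  match a with
  | RelAtom R args => interp A R (map_tuple v args)
  | EqAtom x y => v x == v y
  end.

Definition sat_pp (X : Type) (phi : pp_formula X) (v : X -> A) : Prop :=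
  exists w : 'I_(pp_nbound phi) -> A,
    all (sat_atom (fun z => match z with inl x => v x | inr i => w i end))
        (pp_atoms phi).

(* A k-ary relation on A^n is a kn-ary relation on A: the free variables
   are the pairs (i, j), standing for coordinate j of the i-th argument. *)
Definition pp_definable (n k : nat) (Q : pred (k.-tuple {ffun 'I_n -> A})) :
    Prop :=
  exists phi : pp_formula ('I_k * 'I_n),
    forall t, Q t <-> sat_pp phi (fun ij => tnth t ij.1 ij.2).

End PPFormulas.

Definition pp_power (S S' : signature) (A : relstruct S) (D : relstruct S') :
    Prop :=
  exists (n : nat)
         (rel : forall R : S', pred ((arity R).-tuple {ffun 'I_n -> A}))
         (inh : 0 < #|{ffun 'I_n -> A}|),
    [/\ 0 < n,
        forall R : S', pp_definable (rel R)
      & isomorphic D (RelStruct rel inh)].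

Definition pp_constructs (S S' : signature) (A : relstruct S)
    (B : relstruct S') : Prop :=
  exists2 D : relstruct S', pp_power A D & hom_equiv B D.

Definition digraph_sig : signature := @Signature unit (fun=> 2).

Definition digraph := relstruct digraph_sig.

Definition edge (G : digraph) : rel G :=
  fun x y => interp G (tt : digraph_sig) [tuple x; y].

Definition component (G : digraph) (x : G) : {set G} :=
  [set y | connect (relU (@edge G) (fun u v => edge v u)) x y].

(* The subgraph of [G] induced by [X] is isomorphic to the directed cycle
   of length n on 'I_n, whose edges are the pairs (i, i + 1 mod n). *)
Definition induces_cycle (G : digraph) (X : {set G}) : Prop :=
  exists (n : nat) (g : 'I_n -> G),
    [/\ 0 < n,
        injective g,
        X = [set g i | i : 'I_n]
      & forall i j : 'I_n, edge (g i) (g j) = (j == ordS i)].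

Definition disjoint_union_of_cycles (G : digraph) : Prop :=
  forall x : G, induces_cycle (component x).

Lemma power_gt0 (S : signature) (A : relstruct S) (V : finType) :
  0 < #|{ffun V -> A}|.
Proof. by rewrite card_ffun expn_gt0 dom_gt0. Qed.

Definition power (S : signature) (A : relstruct S) (V : finType) :
    relstruct S :=
  @RelStruct S {ffun V -> A}
    (fun R t => [forall v, interp A R (map_tuple (fun h : {ffun V -> A} => h v) t)])
    (power_gt0 A V).

Definition prime_set (P : {fset nat}) : Prop :=
  P != fset0 /\ forall p, p \in P -> prime p.

(* ['Z_p] is the integers mod p only for p > 1, which [prime_set] ensures. *)
Definition cyc_index (P : {fset nat}) : finType := {p : P & 'Z_(val p)}.

Definition cyc_shift (P : {fset nat}) (x : cyc_index P) : cyc_index P :=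
  Tagged (fun p : P => 'Z_(val p)) (tagged x + 1)%R.

Definition pol_satisfies (S : signature) (A : relstruct S) (P : {fset nat}) :
    Prop :=
  exists2 f : power A (cyc_index P) -> A, is_hom f &
    forall t : {ffun cyc_index P -> A}, f t = f [ffun x => t (cyc_shift x)].

(* Main.v *)
Require Import Defs.
From mathcomp Require Import all_boot all_algebra.
From mathcomp Require Import finmap.

(** Every vertex of C has exactly one out-edge, so C is the graph of a
    permutation u. The free structure of Pol(B) over C has the |C|-ary
    polymorphisms f of B as vertices and an edge from f to t |-> f(t o u); it is
    a pp-power of B, receives a homomorphism from C (projections), and is itself
    a disjoint union of cycles. It maps to C as soon as every f invariant under
    u^n forces u^n to have a fixed point. Suppose f is invariant under a
    fixed-point-free v = u^n, with v of minimal exponent N, and let P be the set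
    of primes dividing N. Every cycle of v has length divisible by some p in P,
    so (C, v) maps to (V_P, sigma_P) and f yields Sigma_P in Pol(B), hence a
    witness g in Pol(C). By minimality each v^p, p in P, has a fixed point, so
    (V_P, sigma_P) maps to (C, v) by some t, and g(t) = g(t o sigma_P) =
    g(v o t) = v(g(t)) is a fixed point of v, a contradiction. *)

Set Implicit Arguments.
Unset Strict Implicit.
Unset Printing Implicit Defensive.

(** * Preservation of loop conditions under pp-constructions *)

Lemma is_hom_comp (S : signature) (A B C : relstruct S) (g : B -> C)
    (f : A -> B) : is_hom g -> is_hom f -> is_hom (g \o f).
Proof.
move=> hg hf R t /hf/hg; congr (interp C R _).
by apply: val_inj; rewrite /= -map_comp.
Qed.

Lemma is_hom_power_postcomp (S : signature) (A B : relstruct S) (V : finType)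
    (f : A -> B) :
  is_hom f -> @is_hom S (power A V) (power B V)
                (fun t : {ffun V -> A} => [ffun v => f (t v)]).
Proof.
move=> hf R t /forallP ht; apply/forallP => v.
move: (hf _ _ (ht v)); congr (interp B R _).
apply: val_inj; rewrite /= -!map_comp; apply: eq_map => x /=.
by rewrite ffunE.
Qed.

Lemma is_hom_power_precomp (S : signature) (A : relstruct S) (V W : finType)
    (u : W -> V) :
  @is_hom S (power A V) (power A W)
    (fun t : {ffun V -> A} => [ffun w => t (u w)]).
Proof.
move=> R t /forallP ht; apply/forallP => w.
move: (ht (u w)); congr (interp A R _).
apply: val_inj; rewrite /= -!map_comp; apply: eq_map => x /=.
by rewrite ffunE.
Qed.

Lemma pol_satisfies_hom_equiv (S : signature) (A B : relstruct S)
    (P : {fset nat}) :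
  hom_equiv A B -> pol_satisfies A P -> pol_satisfies B P.
Proof.
move=> [[b hb] [a ha]] [f hf fP].
exists (b \o (f \o (fun t : {ffun cyc_index P -> B} => [ffun v => a (t v)]))).
  apply: is_hom_comp hb _; apply: is_hom_comp hf _.
  exact: is_hom_power_postcomp.
move=> t /=; rewrite fP; congr (b (f _)).
by apply/ffunP => v; rewrite !ffunE.
Qed.

Lemma isomorphic_hom_equiv (S : signature) (A B : relstruct S) :
  isomorphic A B -> hom_equiv A B.
Proof.
move=> [f [g fK gK] hf]; split; first by exists f => R t; rewrite hf.
exists g => R t; rewrite -hf; congr (interp B R _).
apply: val_inj; rewrite /= -map_comp -[LHS]map_id.
by apply: eq_map => x /=; rewrite gK.
Qed.

(** Polymorphisms preserve conjunctions of atoms. The variable type [X] is arbitrary, so that free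
    and bound variables can be treated alike. *)
Lemma sat_atoms_pol (S : signature) (A : relstruct S) (V : finType)
    (f : power A V -> A) (X : Type) (val : V -> X -> A) (s : seq (atom S X)) :
  is_hom f -> (forall v, all (sat_atom (val v)) s) ->
  all (sat_atom (fun x => f [ffun v => val v x])) s.
Proof.
move=> hf; elim: s => //= a s IHs hs; apply/andP; split; last first.
  by apply: IHs => v; have /andP[] := hs v.
have {hs}: forall v, sat_atom (val v) a by move=> v; have /andP[] := hs v.
case: a => [R args|x y] /= ha; last first.
  by apply/eqP; congr f; apply/ffunP => v; rewrite !ffunE; apply/eqP.
have: interp (power A V) R
    (map_tuple (fun x => [ffun v => val v x] : power A V) args).
  apply/forallP => v; move: (ha v); congr (interp A R _).
  apply: val_inj; rewrite /= -map_comp; apply: eq_map => x /=.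
  by rewrite ffunE.
move/hf; congr (interp A R _).
by apply: val_inj; rewrite /= -map_comp.
Qed.

Lemma pol_satisfies_pp_def (S S' : signature) (A : relstruct S) (n : nat)
    (rel : forall R : S', pred ((arity R).-tuple {ffun 'I_n -> A}))
    (inh : 0 < #|{ffun 'I_n -> A}|) (P : {fset nat}) :
  (forall R : S', pp_definable (rel R)) ->
  pol_satisfies A P -> pol_satisfies (RelStruct rel inh) P.
Proof.
move=> hrel [f hf fP].
pose V := cyc_index P.
exists (fun t : {ffun V -> {ffun 'I_n -> A}} =>
          [ffun i => f [ffun v => t v i]]); last first.
  move=> t; apply/ffunP => i; rewrite !ffunE fP; congr f.
  by apply/ffunP => v; rewrite !ffunE.
move=> R t /forallP ht; have [phi hphi] := hrel R.
have /fin_all_exists[w hw] : forall v : V, exists w : 'I_(pp_nbound phi) -> A,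
    all (sat_atom (fun z => match z with
      | inl x => tnth t x.1 v x.2 | inr i => w i end)) (pp_atoms phi).
  move=> v; have /hphi[w hw] := ht v; exists w.
  move: hw; congr (is_true _); apply: eq_all => -[Q args|x y] /=.
    congr (interp A Q _); apply: eq_from_tnth => i; rewrite !tnth_map.
    by case: (tnth args i) => //= x; rewrite tnth_map.
  by congr (_ == _); [case: x | case: y] => //= z; rewrite tnth_map.
(* The existential witnesses for the image tuple are the [f]-images of those chosen for each [v]. *)
apply/hphi; exists (fun i => f [ffun v => w v i]).
have := sat_atoms_pol hf hw; congr (is_true _); apply: eq_all.
have e z : f [ffun v => match z with
      | inl x => tnth t x.1 v x.2 | inr i => w v i end] =
    match z with
    | inl x => tnth (map_tuple (fun t : {ffun V -> {ffun 'I_n -> A}} =>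
          [ffun i => f [ffun v => t v i]]) t) x.1 x.2
    | inr i => f [ffun v => w v i] end.
  by case: z => // x; rewrite tnth_map ffunE.
case=> [Q args|x y] /=; last by rewrite !e.
by congr (interp A Q _); apply: eq_from_tnth => i; rewrite !tnth_map e.
Qed.

Lemma pol_satisfies_pp_constructs (S S' : signature) (B : relstruct S)
    (C : relstruct S') (P : {fset nat}) :
  pp_constructs B C -> pol_satisfies B P -> pol_satisfies C P.
Proof.
move=> [D [n [rel [inh [_ hrel /isomorphic_hom_equiv[hDE hED]]]]] [hCD hDC]].
move=> /(pol_satisfies_pp_def inh hrel) hE.
apply: (pol_satisfies_hom_equiv (A := D)); first by split.
by apply: pol_satisfies_hom_equiv hE; split.
Qed.

(** * Orbits of injective maps *)

Lemma iter_modn (T : Type) (f : T -> T) (x : T) (m n : nat) :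
  iter m f x = x -> iter (n %% m) f x = iter n f x.
Proof. by move=> h; rewrite [in RHS](divn_eq n m) addnC iterD iterM (iter_fix _ h). Qed.

Lemma dvdn_order_iter (T : finType) (f : T -> T) (x : T) (n : nat) :
  injective f -> (order f x %| n) = (iter n f x == x).
Proof.
move=> f_inj; have fx := iter_order f_inj x.
apply/idP/eqP => [/dvdnP[q ->]|]; first by rewrite iterM iter_fix.
rewrite -(iter_modn n fx) => e.
have lt : n %% order f x < order f x by rewrite ltn_mod order_gt0.
by rewrite /dvdn -(findex_iter lt) e findex0.
Qed.

(* A cycle of [s] maps to [u] as soon as [u] has a cycle whose length divides
   its own; the cycles for which this fails do not affect the others. *)
Lemma equivariant_map (X Y : finType) (s : X -> X) (u : Y -> Y) :
  injective s -> 0 < #|Y| ->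
  exists h : X -> Y, forall x,
    (exists y, iter (order s x) u y = y) -> h (s x) = u (h x).
Proof.
move=> s_inj /card_gt0P[y0 _].
pose r := froot s.
pose y x := odflt y0 [pick y | iter (order s x) u y == y].
exists (fun x => iter (findex s (r x) x) u (y (r x))) => x [z hz].
have s_sym : connect_sym (frel s) by apply: fconnect_sym.
have rs : r (s x) = r x.
  by apply/eqP; rewrite root_connect // s_sym fconnect1.
have rx : fconnect s (r x) x by rewrite s_sym connect_root.
have ox : order s (r x) = order s x.
  exact: eq_card (same_connect s_sym rx).
have yP : iter (order s (r x)) u (y (r x)) = y (r x).
  rewrite /y ox; case: pickP => [t /eqP //|/(_ z)]; by rewrite hz eqxx.
rewrite rs -iterS.
have lt := findex_max rx; have e := iter_findex rx.
have <- : iter (findex s (r x) x).+1 s (r x) = s x by rewrite iterS e.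
move: lt; rewrite leq_eqVlt => /orP[/eqP lt|lt]; last by rewrite findex_iter.
(* Here [s x] is back at the root: the index drops to 0, and [yP] closes the image orbit. *)
by rewrite lt iter_order // findex0 yP.
Qed.

(** * Disjoint unions of cycles as graphs of permutations *)

Lemma cycles_functional (C : digraph) :
  disjoint_union_of_cycles C ->
  exists2 u : C -> C, injective u & forall x y, edge x y = (y == u x).
Proof.
move=> hC.
have hu (x : C) : exists y, forall z, edge x z = (z == y).
  have [n [g [_ g_inj eX gE]]] := hC x.
  have: x \in component x by rewrite inE connect0.
  rewrite eX => /imsetP[i _ xi]; exists (g (ordS i)) => z.
  apply/idP/eqP => [xz|->]; last by rewrite xi gE.
  have: z \in component x by rewrite inE connect1 //= xz.
  rewrite eX => /imsetP[j _ zj]; move: xz; rewrite xi zj gE.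
  by move=> /eqP ->.
have /fin_all_exists[u uE] := hu; exists u => // x x' e.
(* The component of the common image contains both preimages, and [ordS] is injective on its
   cycle. *)
have [n [g [_ g_inj eX gE]]] := hC (u x).
have mem v : edge v (u x) -> exists i, v = g i.
  move=> vx; have: v \in component (u x) by rewrite inE connect1 //= vx orbT.
  by rewrite eX => /imsetP[i _ ->]; exists i.
have [|i xi] := mem x; first by rewrite uE.
have [|i' xi'] := mem x'; first by rewrite uE e.
have: edge x (u x) by rewrite uE.
have: edge x' (u x) by rewrite uE e.
have: u x \in component (u x) by rewrite inE connect0.
rewrite {1}eX => /imsetP[j _ ->]; rewrite xi xi' !gE.
by move=> /eqP -> /eqP /(can_inj (@ordSK _)) ->.
Qed.

Lemma iter_cyc_shift (P : {fset nat}) (p : P) (k : 'Z_(val p)) (n : nat) :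
  iter n (@cyc_shift P) (Tagged (fun p : P => 'Z_(val p)) k) =
  Tagged (fun p : P => 'Z_(val p)) (k + n%:R)%R.
Proof.
elim: n => [|n IHn]; first by rewrite GRing.addr0.
by rewrite iterS IHn /cyc_shift /= -GRing.addrA -GRing.mulrSr.
Qed.

Lemma digraph_interpE (C : digraph) (t : 2.-tuple C) :
  interp C (tt : digraph_sig) t = edge (tnth t ord0) (tnth t ord_max).
Proof.
rewrite /edge; congr (interp C _ _); apply: eq_from_tnth => i.
by case: i => -[|[|//]] lt; apply: (congr1 (tnth t)); apply: val_inj.
Qed.

Section FunctionalDigraph.
Variables (S : signature) (B : relstruct S) (C : digraph) (u : C -> C).
Hypothesis u_inj : injective u.
Hypothesis edgeE : forall x y, edge x y = (y == u x).

(** In a power of [C] the edges are the graph of [u] applied coordinatewise, and a homomorphism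
    between graphs of functions commutes with these functions. *)
Lemma pol_functional_commute (V : finType) (g : power C V -> C)
    (t : {ffun V -> C}) (n : nat) :
  is_hom g -> g [ffun v => iter n u (t v)] = iter n u (g t).
Proof.
move=> hg; elim: n => [|n IHn] /=.
  by congr g; apply/ffunP => v; rewrite ffunE.
set t' := [ffun v => iter n u (t v)] in IHn.
have: edge (g t') (g [ffun v => u (iter n u (t v))]).
  have := hg tt [tuple (t' : power C V); [ffun v => u (iter n u (t v))]].
  rewrite /edge; move=> h; apply: etrans (h _); first congr (interp C _ _).
    exact: val_inj.
  apply/forallP => v; have: edge (t' v) (u (t' v)) by rewrite edgeE.
  rewrite /edge; congr (interp C _ _).
  by apply: val_inj; rewrite /= !ffunE.
by rewrite edgeE IHn => /eqP.
Qed.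

(** The choice of a minimal exponent becomes a strong induction on [N], with [n] varying so that
    [iter n u] can be replaced by its powers. *)
Lemma invariant_pol_fixpoint (f : power B C -> B) (N n : nat) :
  (forall P, prime_set P -> pol_satisfies B P -> pol_satisfies C P) ->
  is_hom f -> 0 < N -> (forall c, iter (N * n) u c = c) ->
  (forall t : {ffun C -> B}, f [ffun c => t (iter n u c)] = f t) ->
  exists c, iter n u c = c.
Proof.
move=> hP hf; elim/ltn_ind: N n => N IHN n N_gt0 uN fn.
have [/existsP[c /eqP]|/existsPn nofix] :=
  boolP [exists c, iter n u c == c]; first by exists c.
pose v := iter n u.
have v_inj : injective v by rewrite /v; elim: (n) => //= m IH x y /u_inj/IH.
have [c0 _] := card_gt0P (dom_gt0 C).
have ordN c : order v c %| N by rewrite dvdn_order_iter // -iterM uN.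
have ord_gt1 c : 1 < order v c.
  rewrite ltn_neqAle order_gt0 andbT eq_sym -dvdn1 dvdn_order_iter //.
  exact: nofix.
pose P := [fset p in primes N]%fset.
have PP p : p \in P = (p \in primes N) by rewrite inE.
have pdivP c : pdiv (order v c) \in P.
  rewrite PP mem_primes N_gt0 pdiv_prime // (dvdn_trans _ (ordN c)) //.
  exact: pdiv_dvd.
have P_prime : prime_set P.
  split; first by apply/fset0Pn; exists (pdiv (order v c0)).
  by move=> p; rewrite PP mem_primes => /and3P[].
have p_gt1 (p : P) : 1 < val p by apply/prime_gt1/P_prime.2/(valP p).
(* The least prime factor p of a cycle length of [v] lies in [P], and (p, 0) returns to itself after
   that many shifts, as [equivariant_map] requires. *)
have [phi phiE] : exists phi : C -> cyc_index P,
    forall c, phi (v c) = cyc_shift (phi c).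
  have V_gt0 : 0 < #|cyc_index P|.
    apply/card_gt0P; exists (Tagged (fun p : P => 'Z_(val p))
      (i := FSetSub (pdivP c0)) 0%R); by rewrite inE.
  have [phi phiP] := equivariant_map (@cyc_shift P) v_inj V_gt0.
  exists phi => c; apply: phiP; pose p : P := FSetSub (pdivP c).
  exists (Tagged (fun p : P => 'Z_(val p)) (i := p) 0%R).
  have /dvdnP[q ->] : val p %| order v c by apply: pdiv_dvd.
  by rewrite iterM iter_fix // iter_cyc_shift GRing.add0r pchar_Zp.
(* The p-th power of [v] has the smaller exponent [q] = N/p and still leaves [f] invariant, so the
   induction hypothesis applies to it. *)
have fixp (p : P) : exists c, iter (val p) v c = c.
  have: val p \in P := valP p.
  rewrite PP mem_primes => /and3P[pp _ /dvdnP[q qN]].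
  have q_gt0 : 0 < q by move: N_gt0; rewrite qN; case: (q).
  suff [c hc] : exists c, iter (val p * n) u c = c by exists c; rewrite -iterM.
  apply: (IHN q _ _ q_gt0) => [|c|t].
  - by rewrite qN ltn_Pmulr // prime_gt1.
  - by rewrite mulnA -qN.
  elim: (val p) t => [|m IHm] t.
    by congr f; apply/ffunP => c; rewrite ffunE.
  rewrite -[RHS]IHm -[RHS]fn; congr f; apply/ffunP => c.
  by rewrite !ffunE mulSn addnC iterD.
have /fin_all_exists[c cP] := fixp.
have [g hg gP] : pol_satisfies C P.
  apply: (hP P P_prime).
  exists (f \o (fun t : {ffun cyc_index P -> B} => [ffun c => t (phi c)])).
    by apply: is_hom_comp hf _; apply: is_hom_power_precomp.
  move=> t /=; rewrite -fn; congr f; apply/ffunP => z.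
  by rewrite !ffunE -phiE.
pose t := [ffun x : cyc_index P => iter (tagged x) v (c (tag x))].
exists (g t); rewrite -pol_functional_commute // [RHS]gP; congr g.
apply/ffunP => -[p k]; rewrite !ffunE /=.
(* The wrap-around from p - 1 to 0 is harmless, since p steps of [v] fix [c p]. *)
rewrite -[LHS]/(iter k.+1 v (c p)) -(iter_modn _ (cP p)); congr iter.
by rewrite modnDmr addn1; congr (_ %% _); rewrite (Zp_cast (p_gt1 p)).
Qed.

(** * The free structure as a pp-power *)

Let n := #|{: {ffun C -> B}}|.
Let op := {ffun {ffun C -> B} -> B}.

Let shift (f : op) : op := [ffun t : {ffun C -> B} => f [ffun c => t (u c)]].

Let decode (x : {ffun 'I_n -> B}) : op := [ffun t : {ffun C -> B} => x (enum_rank t)].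

Let homb (f : op) : bool :=
  [forall R, forall t : (arity R).-tuple (power B C),
    interp (power B C) R t ==> interp B R (map_tuple f t)].

Let homP (f : op) : reflect (is_hom (f : power B C -> B)) (homb f).
Proof.
apply: (iffP forallP) => [h R t ht|h R].
  by have /forallP/(_ t)/implyP := h R; apply.
by apply/forallP => t; apply/implyP; apply: h.
Qed.

(* The edges of the free structure of [Pol(B)] over [C], whose vertices are
   the [C]-ary polymorphisms, coded by their tables. *)
Let free_edge (R : digraph_sig) :
    pred ((arity R).-tuple {ffun 'I_n -> B}) :=
  fun t : 2.-tuple _ =>
    homb (decode (tnth t ord0)) &&
    (decode (tnth t ord_max) == shift (decode (tnth t ord0))).

Lemma free_edge_pp_definable (R : digraph_sig) : pp_definable (@free_edge R).
Proof.
pose x (i : 'I_2) (t : {ffun C -> B}) : 'I_2 * 'I_n + 'I_0 :=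
  inl (i, enum_rank t).
pose hom_atoms := [seq RelAtom (map_tuple (x ord0) a)
  | Q <- enum S, a <- enum (interp (power B C) Q)].
pose shift_atoms := [seq EqAtom S (x ord_max t) (x ord0 [ffun c => t (u c)])
   | t <- enum {ffun C -> B}].
exists (PPFormula (hom_atoms ++ shift_atoms)) => t.
have satE w : all (sat_atom (fun z => match z with
    | inl ij => tnth t ij.1 ij.2 | inr i => w i end))
    (hom_atoms ++ shift_atoms) = free_edge t.
  rewrite all_cat; congr (_ && _).
    apply/all_allpairsP/forallP => h Q => [|a _].
      apply/forallP => a; apply/implyP => ha.
      have := h Q a; rewrite !mem_enum => /(_ isT ha) /=.
      congr (interp B Q _); apply: eq_from_tnth => i.
      by rewrite !tnth_map /= ffunE.
    rewrite mem_enum => ha /=; have /forallP/(_ a)/implyP/(_ ha) := h Q.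
    congr (interp B Q _); apply: eq_from_tnth => i.
    by rewrite !tnth_map /= ffunE.
  rewrite all_map; apply/allP/eqP => [h|h a _].
    by apply/ffunP => a; have /eqP /= := h a (mem_enum _ _); rewrite !ffunE.
  by have /ffunP/(_ a) := h; rewrite !ffunE /= => ->.
split=> [h|[w]]; last by rewrite satE.
have /card_gt0P[b _] := dom_gt0 B.
by exists (fun=> b); rewrite satE.
Qed.

Let shift_inj : injective shift.
Proof.
move=> f g /ffunP e; apply/ffunP => t.
have := e [ffun c => t (invF u_inj c)]; rewrite !ffunE.
suff -> : [ffun c => [ffun c => t (invF u_inj c)] (u c)] = t by [].
by apply/ffunP => c; rewrite !ffunE invF_f.
Qed.

Let iter_shift (k : nat) (f : op) (t : {ffun C -> B}) :
  iter k shift f t = f [ffun c => t (iter k u c)].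
Proof.
elim: k t => [|k IHk] t /=.
  by congr (f _); apply/ffunP => c; rewrite ffunE.
by rewrite ffunE IHk; congr (f _); apply/ffunP => c; rewrite !ffunE.
Qed.

Lemma pp_constructs_functional :
  (forall P, prime_set P -> pol_satisfies B P -> pol_satisfies C P) ->
  pp_constructs B C.
Proof.
move=> hP.
have inh : 0 < #|{ffun 'I_n -> B}| by rewrite card_ffun expn_gt0 dom_gt0.
have n_gt0 : 0 < n by rewrite /n card_ffun expn_gt0 dom_gt0.
exists (RelStruct free_edge inh).
  exists n, free_edge, inh; split=> //; first exact: free_edge_pp_definable.
  exists id; first by exists id.
  by move=> R t; congr (interp _ _ _); apply: val_inj; rewrite /= map_id.
split.
  (* [F c] is the table of the projection to coordinate [c]. *)
  pose F (c : C) := [ffun i : 'I_n => (enum_val i : {ffun C -> B}) c].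
  have decF c : decode (F c) = [ffun t : {ffun C -> B} => t c].
    by apply/ffunP => t; rewrite !ffunE enum_rankK.
  exists F => -[] t; rewrite digraph_interpE edgeE => /eqP e.
  rewrite /= /free_edge !tnth_map !decF e; apply/andP; split; last first.
    by apply/eqP/ffunP => a; rewrite !ffunE.
  apply/homP => R a /forallP/(_ (tnth t ord0)); congr (interp B R _).
  by apply: eq_from_tnth => i; rewrite !tnth_map ffunE.
(* [h] is defined on all operations, but commutation with the shift is needed only at polymorphisms,
   the sources of edges. *)
have [h hE] := equivariant_map u shift_inj (dom_gt0 C).
exists (h \o decode) => -[] t /= /andP[/homP hf /eqP e].
rewrite digraph_interpE edgeE !tnth_map /= e; apply/eqP/hE.
set f := decode (tnth t ord0) in hf *.
(* Every cycle length of [u] is at most [#|C|], so [#|C|] factorial is an exponent of [u]; the power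
   of [u] considered is the orbit length of [f] under [shift]. *)
apply: (@invariant_pol_fixpoint f ((#|C|)`!) _ hP hf (fact_gt0 _)) => [c|a].
  rewrite mulnC iterM iter_fix //; apply/eqP.
  rewrite -dvdn_order_iter //.
  apply: dvdn_fact; rewrite order_gt0; exact: max_card.
by rewrite -iter_shift (iter_order shift_inj).
Qed.

End FunctionalDigraph.

Theorem corollary6p10 (S : signature) (B : relstruct S) (C : digraph)
    (hC : disjoint_union_of_cycles C) :
  pp_constructs B C <->
  (forall P : {fset nat}, prime_set P -> pol_satisfies B P -> pol_satisfies C P).
Proof.
split=> [h P _|]; first exact: pol_satisfies_pp_constructs.
have [u u_inj uE] := cycles_functional hC.
exact: pp_constructs_functional u_inj uE.
Qed.
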